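(* Let $\Phi:\mathbb{R}_{+}\to\mathbb{R}$ be a function that is continuous on $\mathbb{R}_{+}$ and differentiable on $\mathbb{R}_{++}$. Then $\Phi$ is strongly subadditive if and only if $\Phi(0)\geq 0$ and $\Phi'$ is nonincreasing (on $\mathbb{R}_{++}$). Respectively, $\Phi$ is strongly superadditive if and only if $\Phi(0)\leq 0$ and $\Phi'$ is nondecreasing (on $\mathbb{R}_{++}$).
   Context: $\mathbb{R}_{+}=[0,\infty)$ and $\mathbb{R}_{++}=(0,\infty)$. A function $\Phi:\mathbb{R}_{+}\to\mathbb{R}$ is subadditive if $\Phi(x+y)\leq\Phi(x)+\Phi(y)$ for all $x,y\in\mathbb{R}_{+}$. It is strongly subadditive if it is subadditive and in addition $\Phi(x+y+z)+\Phi(z)\leq\Phi(x+z)+\Phi(y+z)$ for all $x,y,z\in\mathbb{R}_{+}$. It is strongly superadditive if $-\Phi$ is strongly subadditive. *)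

(* Defs.v *)
From mathcomp Require Import all_boot all_order all_algebra.
From mathcomp Require Import all_classical all_reals all_analysis.

Set Implicit Arguments.
Unset Strict Implicit.
Unset Printing Implicit Defensive.

Import Order.TTheory GRing.Theory Num.Theory.
Import numFieldNormedType.Exports.
Local Open Scope ring_scope.

(* Functions on [0, +oo[ are represented by functions f : R -> R of which only
   the values on [0, +oo[ are ever used. *)

Definition subadditive_nneg (R : realType) (f : R -> R) : Prop :=
  forall x y : R, 0 <= x -> 0 <= y -> f (x + y) <= f x + f y.

Definition strongly_subadditive (R : realType) (f : R -> R) : Prop :=
  subadditive_nneg f /\
  forall x y z : R, 0 <= x -> 0 <= y -> 0 <= z ->
    f (x + y + z) + f z <= f (x + z) + f (y + z).

Definition strongly_superadditive (R : realType) (f : R -> R) : Prop :=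
  strongly_subadditive (fun x => - f x).

(* Main.v *)
(* Strong subadditivity says that increments of [Phi] of equal length decrease
   as their starting point moves right. Letting the length tend to 0 gives a
   nonincreasing derivative. Conversely, if [x <= y], the intervals
   [[z, x + z]] and [[y + z, x + y + z]] have equal length and disjoint
   interiors, so that the mean value theorem on each of them compares the two
   increments; the case [z = 0] with [0 <= Phi 0] gives subadditivity. The
   superadditive case follows by passing to [- Phi]. *)
Require Import Defs.
From mathcomp Require Import all_boot all_order all_algebra.
From mathcomp Require Import all_classical all_reals all_analysis.
From mathcomp Require Import lra.

Import Order.TTheory GRing.Theory Num.Theory.
Import numFieldNormedType.Exports.
Local Open Scope classical_set_scope.
Local Open Scope ring_scope.

(** A two-sided limit restricts to the right; increments are compared for positive [h] only. *)
Lemma derivable_cvg_right (R : realType) (f : R -> R) (x : R) :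
  derivable f x 1 ->
  h^-1 * (f (h + x) - f x) @[h --> 0^'+] --> f^`()%classic x.
Proof.
move=> df; rewrite derive1E; apply: cvg_dnbhs_at_right.
have -> : (fun h => h^-1 * (f (h + x) - f x)) =
    (fun h => h^-1 *: ((f \o shift x) (h *: 1) - f x)).
  by apply/funext => h /=; rewrite [h *: 1]mulr1.
exact: df.
Qed.

(** Dividing by [h > 0] keeps the inequality, and it passes to the limit of the right difference
    quotients. *)
Lemma le_derive1_increments (R : realType) (f : R -> R) (x y : R) :
  derivable f x 1 -> derivable f y 1 ->
  (forall h, 0 < h -> f (h + x) - f x <= f (h + y) - f y) ->
  f^`()%classic x <= f^`()%classic y.
Proof.
move=> dfx dfy fxy.
apply: (ler_cvg_to (derivable_cvg_right _ _ _ dfx)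
                   (derivable_cvg_right _ _ _ dfy)).
near=> h.
have h0 : 0 < h by near: h; exact: nbhs_right_gt.
by rewrite ler_pM2l ?invr_gt0// fxy.
Unshelve. all: by end_near. Qed.

Lemma strongly_subadditiveP (R : realType) (f : R -> R)
    (f_cont : {within `[0, +oo[, continuous f})
    (f_deriv : forall x : R, 0 < x -> derivable f x 1) :
  strongly_subadditive f <->
    0 <= f 0 /\ {in `]0, +oo[ &, nonincreasing_fun f^`()%classic}.
Proof.
split=> [[sub ssub]|[f0 df_ni]].
  split=> [|x y].
    by have := sub 0 0 (lexx 0) (lexx 0); rewrite addr0; lra.
  rewrite !in_itv/= !andbT => x0 y0 xy.
  apply: le_derive1_increments => [||h h0]; [exact: f_deriv..|].
  (* The shift [y - x] moves the increment of length [h] from [x] to [y]. *)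
  have := ssub h (y - x) x (ltW h0).
  by rewrite -addrA subrK subr_ge0 => /(_ xy (ltW x0)); lra.
(* The case [a = 0] is included: continuity suffices at the endpoint, and [c > a] is positive. *)
have mvt a b : 0 <= a -> a < b ->
    exists2 c, a < c < b & f b - f a = f^`()%classic c * (b - a).
  move=> a0 ab; have [c||c cab] := @MVT _ f f^`()%classic a b ab.
  - rewrite in_itv/= => /andP[ac _]; rewrite derive1E.
    by apply/derivableP/f_deriv; exact: le_lt_trans ac.
  - apply: continuous_subspaceW f_cont => c /=.
    by rewrite !in_itv/= andbT => /andP[ac _]; exact: le_trans ac.
  - by move: cab; rewrite in_itv/=; exists c.
have ssub x y z : 0 <= x -> 0 <= y -> 0 <= z ->
    f (x + y + z) + f z <= f (x + z) + f (y + z).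
  wlog xy : x y / x <= y => [wl x0 y0 z0|].
    have [xy|/ltW yx] := leP x y; first exact: wl.
    by rewrite (addrC x y) [leRHS]addrC; exact: wl.
  (* For [x = 0] the intervals degenerate, but both sides agree. *)
  rewrite le_eqVlt => /predU1P[<- _ _|x0 y0 z0]; first by rewrite !add0r addrC.
  have [||c /andP[zc cx] fx] := mvt z (x + z); [lra..|].
  have [||d /andP[yd dy] fy] := mvt (y + z) (x + y + z); [lra..|].
  (* Here [c < x + z <= y + z < d], by the choice [x <= y]. *)
  have dc : f^`()%classic d <= f^`()%classic c.
    by apply: df_ni; rewrite ?in_itv/= ?andbT; lra.
  have : f^`()%classic d * x <= f^`()%classic c * x by rewrite ler_pM2r.
  move: fx fy; rewrite -(addrA x y z) !addrK.
  lra.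
split=> // x y x0 y0.
by have := ssub x y 0 x0 y0 (lexx 0); rewrite !addr0; lra.
Qed.

Theorem theorem2 (R : realType) (Phi : R -> R)
    (Phi_cont : {within `[0, +oo[, continuous Phi})
    (Phi_deriv : forall x : R, 0 < x -> derivable Phi x 1) :
  (strongly_subadditive Phi <->
     0 <= Phi 0 /\ {in `]0, +oo[ &, nonincreasing_fun Phi^`()%classic}) /\
  (strongly_superadditive Phi <->
     Phi 0 <= 0 /\ {in `]0, +oo[ &, nondecreasing_fun Phi^`()%classic}).
Proof.
split; first exact: strongly_subadditiveP.
have NPhi_cont : {within `[0, +oo[, continuous (- Phi)}.
  by move=> x; apply: continuousN; exact: Phi_cont.
have NPhi_deriv x : 0 < x -> derivable (- Phi) x 1.
  by move=> x0; apply/derivableN/Phi_deriv.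
(* Restricted to positive [x], where [Phi] is known to be differentiable. *)
have dN x : x \in `]0, +oo[ -> (- Phi)^`()%classic x = - Phi^`()%classic x.
  by rewrite in_itv/= andbT => x0; rewrite !derive1E deriveN//; exact: Phi_deriv.
apply: (iff_trans (strongly_subadditiveP _ _ NPhi_cont NPhi_deriv)).
rewrite oppr_ge0; split=> -[Phi0 dPhi]; split=> // x y x0 y0 xy.
  by have := dPhi x y x0 y0 xy; rewrite !dN// lerN2.
by rewrite !dN// lerN2; exact: dPhi.
Qed.
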